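(* Let $\mathbb{K}$ be a field of characteristic zero and let $G$ be a finite group acting on the exterior algebra $\bigwedge(V)$. Then $\beta_V(G)\le |G|$ for every finite-dimensional $\mathbb{K}$-vector space $V$ (with $G$-action); that is, the algebra of invariants $\bigwedge(V)^G$ is generated as a $\mathbb{K}$-algebra by invariants of degree at most $|G|$.
   Context: $V$ is a finite-dimensional linear representation of $G$ over $\mathbb{K}$, and $G$ acts on the exterior algebra $\bigwedge(V)=\bigoplus_{d\ge 0}\bigwedge^d(V)$ by the induced degree-preserving algebra automorphisms. The algebra of invariants is $\bigwedge(V)^G=\{f\in\bigwedge(V): g\cdot f=f \text{ for all } g\in G\}$. The number $\beta_V(G)$ is the smallest integer $\beta$ such that $\bigwedge(V)^G$ is generated as a $\mathbb{K}$-algebra by invariants of degree at most $\beta$. *)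

(* Defs.v *)
From HB Require Import structures.
From mathcomp Require Import all_boot all_order all_algebra all_fingroup all_field.
From mathcomp Require Import ring.

Set Implicit Arguments.
Unset Strict Implicit.
Unset Printing Implicit Defensive.

Import GRing.Theory.
Local Open Scope ring_scope.

(* Exterior algebra of a finite-dimensional space V, as the free vector space *)
(* on the sets S of indices of the basis b := vbasis {:V}: the basis vector   *)
(* indexed by S = {i_1 < ... < i_d} stands for b_(i_1) /\ ... /\ b_(i_d).     *)
(* The universal property, which characterizes it independently of b, is      *)
(* given by ext_iota_sqr0, ext_lift_iota, ext_lift1, ext_liftM and            *)
(* ext_lift_unique.                                                           *)
Definition ext (K : fieldType) (V : vectType K) : Type :=
  {ffun {set 'I_(\dim {:V})} -> K^o}.

HB.instance Definition _ (K : fieldType) (V : vectType K) :=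
  Vector.copy (ext V) {ffun {set 'I_(\dim {:V})} -> K^o}.

Section ExteriorAlgebra.

Variables (K : fieldType) (V : vectType K).
Local Notation n := (\dim {:V}).
Implicit Types (S T W A B : {set 'I_n}) (x y z : ext V) (i j : 'I_n).

Definition inversions S T : nat := (\sum_(i in S) \sum_(j in T) (j < i))%N.

Definition ext_basis S : ext V := [ffun T : {set 'I_n} => (T == S)%:R].

(* b_S /\ b_T = (-1)^(number of inversions) b_(S u T) if S, T are disjoint,   *)
(* and 0 otherwise.                                                           *)
Definition ext_mul x y : ext V :=
  [ffun W : {set 'I_n} => \sum_(S : {set 'I_n} | S \subset W)
     (-1) ^+ inversions S (W :\: S) * ((x S : K) * (y (W :\: S) : K))].

Lemma sumn_setU A B (F : 'I_n -> nat) : [disjoint A & B] ->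
  (\sum_(i in A :|: B) F i = \sum_(i in A) F i + \sum_(i in B) F i)%N.
Proof.
by move=> dAB; rewrite -bigU //; apply: eq_bigl => i; rewrite !inE.
Qed.

Lemma inversionsUl A B T : [disjoint A & B] ->
  inversions (A :|: B) T = (inversions A T + inversions B T)%N.
Proof. exact: sumn_setU. Qed.

Lemma inversionsUr S A B : [disjoint A & B] ->
  inversions S (A :|: B) = (inversions S A + inversions S B)%N.
Proof.
by move=> dAB; rewrite -big_split; apply: eq_bigr => i _; apply: sumn_setU.
Qed.

Lemma inversions0l T : inversions set0 T = 0%N.
Proof. by rewrite /inversions big_set0. Qed.

Lemma inversions0r S : inversions S set0 = 0%N.
Proof. by rewrite /inversions big1 // => i _; rewrite big_set0. Qed.

Lemma ext_mulA : associative ext_mul.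
Proof.
move=> x y z; apply/ffunP => W; rewrite !ffunE.
under eq_bigr => A sAW do rewrite ffunE mulr_sumr mulr_sumr.
under [RHS]eq_bigr => S sSW do rewrite ffunE mulr_suml mulr_sumr.
rewrite [RHS](exchange_big_dep (fun A => A \subset W)) /=; last first.
  by move=> S A sSW sAS; apply: subset_trans sAS sSW.
apply: eq_bigr => A sAW.
rewrite [RHS](reindex_onto (fun B => A :|: B) (fun S => S :\: A)) /=; last first.
  by move=> S /andP[_ sAS]; apply/setP=> i; rewrite !inE; case: (boolP (i \in A)) => // /(subsetP sAS) ->.
apply: eq_big => [B|B sB].
  rewrite subUset sAW subsetUl andbT /= setDUl setDv set0U subsetD.
  by congr (_ && _); apply/idP/eqP => [/setDidPl | /setDidPl].
have /subsetDP[sBW dBA] := sB.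
have dAB : [disjoint A & B] by rewrite disjoint_sym.
have DAB : (A :|: B) :\: A = B by rewrite setDUl setDv set0U; apply/setDidPl.
rewrite DAB setDDl.
set C := W :\: (A :|: B).
have -> : W :\: A = B :|: C.
  apply/setP=> i; rewrite !inE; case: (boolP (i \in B)) => /= iB; last by rewrite orbF.
  by rewrite (subsetP sBW) // (disjointFr dBA).
have dBC : [disjoint B & C].
  by rewrite -setI_eq0; apply/eqP/setP=> i; rewrite !inE; case: (i \in B); rewrite ?orbT.
rewrite inversionsUl // inversionsUr // !exprD.
have mulACA (p q r a b c : K) :
  p * q * (a * (r * (b * c))) = q * r * (p * (a * b) * c) by ring.
exact: mulACA.
Qed.

Lemma ext_mul1l : left_id (ext_basis set0) ext_mul.
Proof.
move=> x; apply/ffunP=> W; rewrite !ffunE (bigD1 set0) ?sub0set //= big1 => [|S /andP[_ S0]].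
  by rewrite ffunE eqxx setD0 inversions0l mul1r mul1r addr0.
by rewrite ffunE (negPf S0) mul0r mulr0.
Qed.

Lemma ext_mul1r : right_id (ext_basis set0) ext_mul.
Proof.
move=> x; apply/ffunP=> W; rewrite !ffunE (bigD1 W) //= big1 => [|S /andP[sSW SW]].
  by rewrite ffunE setDv eqxx inversions0r mul1r mulr1 addr0.
rewrite ffunE setD_eq0; case: (boolP (W \subset S)) => [sWS|_]; last by rewrite !mulr0.
by case/eqP: SW; apply/eqP; rewrite eqEsubset sSW.
Qed.

Lemma ext_mulDl : left_distributive ext_mul +%R.
Proof.
move=> x y z; apply/ffunP=> W; rewrite !ffunE -big_split /=.
by apply: eq_bigr => S _; rewrite ffunE mulrDl mulrDr.
Qed.

Lemma ext_mulDr : right_distributive ext_mul +%R.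
Proof.
move=> x y z; apply/ffunP=> W; rewrite !ffunE -big_split /=.
by apply: eq_bigr => S _; rewrite ffunE !mulrDr.
Qed.

Lemma ext_oner_neq0 : ext_basis set0 != 0.
Proof. by apply/eqP => /ffunP/(_ set0); rewrite !ffunE eqxx => /eqP; rewrite oner_eq0. Qed.

HB.instance Definition _ := GRing.Zmodule_isNzRing.Build (ext V)
  ext_mulA ext_mul1l ext_mul1r ext_mulDl ext_mulDr ext_oner_neq0.

Lemma ext_scalerAl (a : K) x y : a *: (x * y) = (a *: x) * y.
Proof.
apply/ffunP=> W; rewrite !ffunE [LHS]mulr_sumr; apply: eq_bigr => S _.
by rewrite ffunE mulrCA -mulrA.
Qed.

Lemma ext_scalerAr (a : K) x y : a *: (x * y) = x * (a *: y).
Proof.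
apply/ffunP=> W; rewrite !ffunE [LHS]mulr_sumr; apply: eq_bigr => S _.
by rewrite ffunE mulrCA; congr (_ * _); rewrite mulrCA.
Qed.

HB.instance Definition _ := GRing.Lmodule_isLalgebra.Build K (ext V) ext_scalerAl.
HB.instance Definition _ := GRing.Lalgebra_isAlgebra.Build K (ext V) ext_scalerAr.
HB.instance Definition _ := Algebra_isFalgebra.Build K (ext V).

Lemma ext_sum x : x = \sum_S (x S : K) *: ext_basis S.
Proof.
apply/ffunP=> T; rewrite sum_ffunE (bigD1 T) //= big1 => [|S ST].
  by rewrite !ffunE eqxx addr0 [RHS]mulr1.
by rewrite !ffunE eq_sym (negPf ST); apply: mulr0.
Qed.

Lemma ext_basis0 : ext_basis set0 = 1. Proof. by []. Qed.

Lemma ext_basis1M i T : ext_basis [set i] * ext_basis T =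
  if i \in T then 0 else (-1) ^+ inversions [set i] T *: ext_basis (i |: T).
Proof.
apply/ffunP=> W; rewrite ffunE.
transitivity (if (i \in W) && (W :\ i == T)
              then (-1) ^+ inversions [set i] T else 0 : K).
  case: (boolP (i \in W)) => iW /=; last first.
    rewrite big1 // => S sSW; rewrite ffunE; case: eqP => [Si|_]; last by rewrite mul0r mulr0.
    by rewrite Si sub1set (negPf iW) in sSW.
  rewrite (bigD1 [set i]) ?sub1set //= big1 => [|S /andP[_ Si]]; last first.
    by rewrite ffunE (negPf Si) mul0r mulr0.
  rewrite !ffunE eqxx addr0 mul1r; case: eqP => [->|_]; first exact: mulr1.
  exact: mulr0.
case: (boolP (i \in T)) => iT.
  rewrite ffunE; case: eqP => [TW|_]; last by rewrite andbF.
  by move: iT; rewrite -TW !inE eqxx.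
rewrite !ffunE; case: (boolP (W == i |: T)) => [/eqP->|WT].
  by rewrite setU11 setU1K // eqxx; symmetry; apply: mulr1.
case: ifP => [/andP[iW /eqP TW]|_]; last by symmetry; apply: mulr0.
by case/eqP: WT; rewrite -TW setD1K.
Qed.

Definition ext_iota_fun (v : V) : ext V :=
  \sum_i coord (vbasis {:V}) i v *: ext_basis [set i].

Fact ext_iota_fun_is_linear : linear ext_iota_fun.
Proof.
move=> a u v; rewrite /ext_iota_fun scaler_sumr -big_split /=.
by apply: eq_bigr => i _; rewrite linearP scalerDl scalerA.
Qed.

HB.instance Definition _ :=
  GRing.isLinear.Build K V (ext V) _ ext_iota_fun ext_iota_fun_is_linear.

Definition ext_iota : 'Hom(V, ext V) := linfun ext_iota_fun.

Lemma ext_iotaE v :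
  ext_iota v = \sum_i coord (vbasis {:V}) i v *: ext_basis [set i].
Proof. by rewrite lfunE. Qed.

Lemma ext_iota_basis i : ext_iota (vbasis {:V})`_i = ext_basis [set i].
Proof.
rewrite ext_iotaE (bigD1 i) //= big1 => [|j ji].
  by rewrite coord_free ?(basis_free (vbasisP _)) // eqxx scale1r addr0.
by rewrite coord_free ?(basis_free (vbasisP _)) // eq_sym (negPf ji) scale0r.
Qed.

Lemma ext_iota_sqr0 v : ext_iota v * ext_iota v = 0.
Proof.
rewrite ext_iotaE; set c := coord _; set a := fun i => c i v *: ext_basis [set i].
have aC i j : a i * a j = - (a j * a i).
  rewrite /a -!scalerAl -!scalerAr !ext_basis1M !inE eq_sym.
  case: eqVneq => [_|ij]; first by rewrite !scaler0 oppr0.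
  rewrite scalerA scalerA scalerA scalerA setUC -scaleNr; congr (_ *: _).
  rewrite [c j v * c i v]mulrC -mulrN; congr (_ * _).
  rewrite /inversions !big_set1; case: (ltngtP i j) ij => [|//|/ord_inj->]; rewrite ?eqxx //.
  by move=> _ _; rewrite expr0 expr1 opprK.
have aa i : a i * a i = 0.
  by rewrite /a -!scalerAl -!scalerAr ext_basis1M inE eqxx !scaler0.
elim: (index_enum _) => [|i r IHr]; first by rewrite big_nil mul0r.
rewrite big_cons mulrDl !mulrDr aa IHr addr0 add0r.
rewrite mulr_sumr mulr_suml -big_split big1 //= => j _.
by rewrite -/(a i) -/(a j) aC addNr.
Qed.

Section Lift.

Variables (R : algType K) (f : V -> R).

Definition ext_lift x : R :=
  \sum_(S : {set 'I_n}) (x S : K) *: \prod_(i in S) f (vbasis {:V})`_i.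

Fact ext_lift_is_linear : linear ext_lift.
Proof.
move=> a x y; rewrite /ext_lift scaler_sumr -big_split /=.
by apply: eq_bigr => S _; rewrite !ffunE scalerDl scalerA.
Qed.

HB.instance Definition _ :=
  GRing.isLinear.Build K (ext V) R _ ext_lift ext_lift_is_linear.

Lemma ext_lift_basis S :
  ext_lift (ext_basis S) = \prod_(i in S) f (vbasis {:V})`_i.
Proof.
rewrite /ext_lift (bigD1 S) //= ffunE eqxx scale1r.
rewrite [X in _ + X]big1 ?addr0 // => T TS.
by rewrite ffunE (negPf TS) scale0r.
Qed.

Lemma ext_lift1 : ext_lift 1 = 1.
Proof. by rewrite -ext_basis0 ext_lift_basis big_set0. Qed.

End Lift.

End ExteriorAlgebra.

Section Universal.

Variables (K : fieldType) (V : vectType K) (R : algType K) (f : {linear V -> R}).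
Hypothesis ff0 : forall v, f v * f v = 0.
Local Notation n := (\dim {:V}).
Local Notation b := (vbasis {:V}).
Implicit Types (S T : {set 'I_n}) (x y : ext V) (i j : 'I_n).

Lemma ext_anticomm u v : f u * f v = - (f v * f u).
Proof.
have /eqP := ff0 (u + v); rewrite linearD mulrDl !mulrDr !ff0 addr0 add0r addr_eq0.
by move/eqP.
Qed.

Let F S : R := \prod_(i in S) f b`_i.

Lemma ext_prod_in i T : i \in T -> f b`_i * F T = 0.
Proof.
move=> iT; rewrite /F; have: i \in index_enum 'I_n by rewrite mem_index_enum.
elim: (index_enum _) => // k r IHr; rewrite inE big_cons.
case: eqVneq => [<- _|_ /= ir]; first by rewrite iT mulrA ff0 mul0r.
case: ifP => _; last exact: IHr.
by rewrite mulrA ext_anticomm mulNr -mulrA IHr // mulr0 oppr0.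
Qed.

Lemma ext_prod_notin i T : i \notin T ->
  f b`_i * F T = (-1) ^+ inversions [set i] T *: F (i |: T).
Proof.
move=> iT; rewrite /F /inversions big_set1.
have: i \in index_enum 'I_n by rewrite mem_index_enum.
have: sorted (fun j k : 'I_n => (j < k)%N) (index_enum 'I_n).
  have -> : index_enum 'I_n = enum 'I_n by rewrite enumT.
  by have := iota_ltn_sorted 0 n; rewrite -val_enum_ord sorted_map.
elim: (index_enum _) => // k r IHr /= srt; rewrite inE !big_cons.
have lt_k j : j \in r -> (k < j)%N.
  by move: srt; rewrite path_sortedE => [/andP[/allP H _] /H //|? ? ?]; apply: ltn_trans.
case: eqVneq => [ik _|ik /= ir].
  rewrite -ik (negPf iT) setU11 in lt_k *.
  have -> : (\sum_(j <- r | j \in T) (j < i) = 0)%N.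
    rewrite big_seq_cond big1 // => j /andP[/lt_k ij _].
    by rewrite ltnNge ltnW.
  rewrite expr0 scale1r; congr (_ * _); rewrite big_seq_cond [RHS]big_seq_cond.
  apply: eq_bigl => j; rewrite !inE; case: eqVneq => //= ji; rewrite ?andbT.
  by case: (boolP (j \in r)) => //= /lt_k; rewrite ji ltnn.
have {}IHr := IHr (path_sorted srt) ir.
rewrite !inE eq_sym (negPf ik) /=; case: ifP => _; last exact: IHr.
rewrite (lt_k _ ir) add1n exprS mulN1r mulrA ext_anticomm mulNr -mulrA IHr.
by rewrite scaleNr scalerAr.
Qed.

Lemma ext_lift_basisM i x :
  ext_lift f (ext_basis [set i] * x) = f b`_i * ext_lift f x.
Proof.
rewrite {1}(ext_sum x) mulr_sumr linear_sum /= [in RHS]/ext_lift mulr_sumr.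
apply: eq_bigr => T _; rewrite -scalerAr linearZ -scalerAr; congr (_ *: _).
rewrite ext_basis1M; case: ifP => [iT|/negbT iT]; first by rewrite linear0 ext_prod_in.
by rewrite linearZ /= ext_lift_basis ext_prod_notin.
Qed.

End Universal.

Lemma ext_basisE (K : fieldType) (V : vectType K) (S : {set 'I_(\dim {:V})}) :
  ext_basis S = \prod_(i in S) ext_iota V (vbasis {:V})`_i.
Proof.
move: {2}_.+1 (ltnSn #|S|) => m; elim: m S => // m IHm S.
case: (set_0Vmem S) => [->|[i iS]]; first by rewrite big_set0.
rewrite (cardsD1 i S) iS add1n ltnS => /IHm IH.
have niS : i \notin S :\ i by rewrite !inE eqxx.
have := ext_prod_notin (@ext_iota_sqr0 _ V) niS.
rewrite /= -IH ext_iota_basis ext_basis1M (negPf niS) setD1K //.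
by apply: scalerI; rewrite signr_eq0.
Qed.

Section Universal2.

Variables (K : fieldType) (V : vectType K) (R : algType K) (f : {linear V -> R}).
Hypothesis ff0 : forall v, f v * f v = 0.

Lemma ext_lift_iota v : ext_lift f (ext_iota V v) = f v.
Proof.
rewrite ext_iotaE linear_sum {2}(coord_vbasis (memvf v)) linear_sum /=.
apply: eq_bigr => i _; rewrite linearZ [in RHS]linearZ /=; congr (_ *: _).
by rewrite ext_lift_basis big_set1.
Qed.

Lemma ext_liftM : {morph ext_lift f : x y / x * y}.
Proof.
move=> x y; rewrite {1}(ext_sum x) mulr_suml linear_sum /= [X in _ = X * _]/ext_lift mulr_suml.
apply: eq_bigr => S _; rewrite -!scalerAl linearZ /=; congr (_ *: _).
rewrite ext_basisE; elim: (index_enum _) => [|i r IHr].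
  by rewrite !big_nil !mul1r.
rewrite !big_cons; case: ifP => // _.
by rewrite -!mulrA -IHr ext_iota_basis ext_lift_basisM.
Qed.

Lemma ext_lift_unique (g : {lrmorphism ext V -> R}) :
  (forall v, g (ext_iota V v) = f v) -> g =1 ext_lift f.
Proof.
move=> gf x; rewrite {1}(ext_sum x) linear_sum; apply: eq_bigr => S _.
rewrite linearZ ext_basisE rmorph_prod; congr (_ *: _).
by apply: eq_bigr => i _; apply: gf.
Qed.

End Universal2.

Section Invariants.

Variables (K : fieldType) (V : vectType K).
Implicit Types (u : 'End(V)) (d : nat) (x y : ext V).

(* The algebra endomorphism of ext V extending u.                             *)
Definition ext_map u : 'End(ext V) := linfun (ext_lift (ext_iota V \o u)%VF).

Lemma ext_mapE u x : ext_map u x = ext_lift (ext_iota V \o u)%VF x.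
Proof. by rewrite lfunE. Qed.

Lemma ext_map_iota u v : ext_map u (ext_iota V v) = ext_iota V (u v).
Proof. by rewrite ext_mapE ext_lift_iota /= comp_lfunE. Qed.

Lemma ext_map1 u : ext_map u 1 = 1.
Proof. by rewrite ext_mapE ext_lift1. Qed.

Lemma ext_mapM u : {morph ext_map u : x y / x * y}.
Proof.
move=> x y; rewrite !ext_mapE ext_liftM // => v.
by rewrite /= comp_lfunE ext_iota_sqr0.
Qed.

Lemma ext_map_id : ext_map \1%VF = \1%VF.
Proof.
apply/lfunP => x; rewrite id_lfunE {1}(ext_sum x) linear_sum [RHS]ext_sum.
apply: eq_bigr => S _; rewrite linearZ /=; congr (_ *: _).
rewrite ext_mapE ext_lift_basis [RHS]ext_basisE.
by apply: eq_bigr => i _; rewrite comp_lfunE id_lfunE.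
Qed.

Lemma ext_map_comp u v : ext_map (u \o v)%VF = (ext_map u \o ext_map v)%VF.
Proof.
apply/lfunP => x; rewrite (ext_sum x) !linear_sum.
apply: eq_bigr => S _; rewrite !linearZ /=; congr (_ *: _).
rewrite comp_lfunE !ext_mapE !ext_lift_basis -ext_mapE.
rewrite (big_morph _ (ext_mapM u) (ext_map1 u)).
by apply: eq_bigr => i _; rewrite !comp_lfunE ext_map_iota.
Qed.

(* The d-th exterior power: the span of the products of d vectors of V.       *)
Definition ext_pow d : {vspace ext V} := (limg (ext_iota V) ^+ d)%VS.

Definition ext_le d : {vspace ext V} := (\sum_(i < d.+1) ext_pow i)%VS.

Lemma ext_basis_pow S : ext_basis S \in ext_pow #|S|.
Proof.
rewrite ext_basisE -big_filter deprecated_filter_index_enum cardE; elim: (enum S) => [|i r IHr].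
  by rewrite big_nil memv_line.
by rewrite big_cons /ext_pow expvSl memv_mul // memv_img ?memvf.
Qed.

Lemma ext_le_full : ext_le (\dim {:V}) = fullv.
Proof.
apply/eqP; rewrite eqEsubv subvf; apply/subvP => x _; rewrite (ext_sum x).
apply: memv_suml => S _; apply: memvZ.
have cS : (#|S| < (\dim {:V}).+1)%N by rewrite ltnS -[X in (_ <= X)%N]card_ord max_card.
by apply: subvP (ext_basis_pow S); apply: (sumv_sup (Ordinal cS)).
Qed.

Variables (gT : finGroupType) (G : {group gT}) (rho : gT -> 'End(V)).

Definition linear_repr : Prop :=
  rho 1%g = \1%VF /\ {in G &, forall g h, rho (g * h)%g = (rho g \o rho h)%VF}.

Definition ext_invariants : {vspace ext V} :=
  (\bigcap_(g in G) fixedSpace (ext_map (rho g)))%VS.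

Lemma ext_invariantsP x :
  reflect (forall g, g \in G -> ext_map (rho g) x = x) (x \in ext_invariants).
Proof.
rewrite memvE; apply: (iffP subv_bigcapP) => H g Gg.
  by apply/fixedSpaceP; rewrite memvE H.
by rewrite -memvE; apply/fixedSpaceP/H.
Qed.

(* agenv U is the unital subalgebra generated by U.                           *)
Definition ext_generated d : bool :=
  agenv (ext_invariants :&: ext_le d) == ext_invariants.

Lemma ext_generated_ex : exists d, ext_generated d.
Proof.
exists (\dim {:V}); rewrite /ext_generated ext_le_full capvf eqEsubv sub_agenv andbT.
apply: agenv_sub_modl.
  by rewrite -memvE; apply/ext_invariantsP => g _; rewrite ext_map1.
apply/prodvP => x y /ext_invariantsP Hx /ext_invariantsP Hy.
by apply/ext_invariantsP => g Gg; rewrite ext_mapM Hx ?Hy.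
Qed.

Definition ext_beta : nat := ex_minn ext_generated_ex.

End Invariants.

(* Main.v *)
(** Invariants are spanned by the transfers [Tr(v_1 /\ ... /\ v_d)], so it
    suffices to express those with [d > |G|] through shorter ones.  For a
    labelling of the positions [1..d] by [k] labels, all of them used, let [E] be
    the sum, over the injective maps [f] from labels to [G], of the ordered
    products of the [f(label i) v_i].  Dropping the injectivity condition at one
    label factors the sum, up to a sign, into a shorter [E] times a shorter
    transfer, and the terms so added are [E]'s in which that label is merged with
    another one.  Hence [E = (-1)^(k-1) (k-1)! Tr(v_1 /\ ... /\ v_d)] modulo the
    algebra generated by shorter transfers.  With [k = d > |G|] there is no
    injective map, so [E = 0], and [(d-1)!] is invertible in characteristic 0. *)

Require Import Defs.
From mathcomp Require Import all_boot all_order all_algebra all_fingroup all_field.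

Set Implicit Arguments.
Unset Strict Implicit.
Unset Printing Implicit Defensive.

Import GRing.Theory.
Local Open Scope ring_scope.

(** * Sums over injective labellings of an anticommuting family *)

Section AnticommutingPowerSums.

Variables (K : fieldType) (A : falgType K) (I : finType) (X : eqType).
Variable a : I -> X -> A.
Hypothesis aC : forall g u h v, a g u * a h v = - (a h v * a g u).

Implicit Types (t : seq I) (g : I) (w : seq X) (s : seq (nat * X)).

Definition power_sum w : A := \sum_g \prod_(v <- w) a g v.

(* [nth] needs a default value, which is never reached for labels < size t. *)
Variable g0 : I.

Definition label_prod t s : A := \prod_(p <- s) a (nth g0 t p.1) p.2.

Definition inj_sum k s : A := \sum_(t : k.-tuple I | uniq t) label_prod t s.

(** With at least two labels, surjectivity makes the zero and nonzero parts of [s] both nonempty,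
    hence both shorter than [s]. *)
Definition all_labels_used k s :=
  all (gtn k) (unzip1 s) /\ {subset iota 0 k <= unzip1 s}.

(** Here [j] is counted after the shift: label 0 joins the old label [j.+1]. *)
Definition merge_label0 (j l : nat) : nat := if l is l'.+1 then l' else j.

Definition relabel (m : nat -> nat) s := [seq (m p.1, p.2) | p <- s].

Definition nonzero_part s := [seq p <- s | p.1 != 0].
Definition zero_part s := [seq p <- s | p.1 == 0].

(** * Splitting off label 0 *)

Lemma mul_label_prodC g v t s :
  a g v * label_prod t s = (-1) ^+ size s * (label_prod t s * a g v).
Proof.
rewrite /label_prod; elim: s => [|p s IHs]; first by rewrite big_nil mulr1 !mul1r.
rewrite big_cons mulrA aC mulNr -[in LHS]mulrA IHs /= exprS mulN1r mulNr.
by rewrite !mulrA (commr_sign _ (size s)).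
Qed.

(** The sign depends only on the order of labels in [s]; since [e] is chosen before [t], it can be
    pulled out of sums over [t]. *)
Lemma label_prod_split s : exists e : nat, forall t,
  label_prod t s = (-1) ^+ e * (label_prod t (nonzero_part s) *
                                label_prod t (zero_part s)).
Proof.
elim: s => [|p s [e IHs]].
  by exists 0 => t; rewrite /label_prod !big_nil !mulr1.
have consE t p' s' : label_prod t (p' :: s') = a (nth g0 t p'.1) p'.2 * label_prod t s'.
  by rewrite /label_prod big_cons.
rewrite /nonzero_part /zero_part /=.
case: eqP => _ /=; last first.
  exists e => t; rewrite !consE IHs !mulrA; congr (_ * _ * _).
  exact: commr_sign.
exists (e + size (nonzero_part s))%N => t; rewrite !consE IHs.
rewrite [LHS]mulrA (commr_sign _ e) exprD -[LHS]mulrA -[RHS]mulrA; congr (_ * _).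
by rewrite [LHS]mulrA mul_label_prodC !mulrA.
Qed.

Lemma label_prod_shift g t s :
  label_prod (g :: t) (nonzero_part s) =
  label_prod t (relabel predn (nonzero_part s)).
Proof.
rewrite /label_prod /relabel big_map /nonzero_part !big_filter.
by apply: eq_bigr => -[[|l] v].
Qed.

Lemma label_prod_zero g t s :
  label_prod (g :: t) (zero_part s) = \prod_(v <- unzip2 (zero_part s)) a g v.
Proof.
rewrite /label_prod big_map /zero_part !big_filter.
by apply: eq_bigr => -[[|l] v].
Qed.

Lemma label_prod_merge j t s :
  label_prod (nth g0 t j :: t) s = label_prod t (relabel (merge_label0 j) s).
Proof. by rewrite /label_prod big_map; apply: eq_bigr => -[[|l] v]. Qed.

Lemma unzip1_relabel m s : unzip1 (relabel m s) = map m (unzip1 s).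
Proof. by rewrite /unzip1 /relabel -!map_comp. Qed.

Lemma unzip2_relabel m s : unzip2 (relabel m s) = unzip2 s.
Proof. by rewrite /unzip2 /relabel -map_comp. Qed.

(** The element [g] at label 0 must avoid the tuple [t] of the others. Letting [g] run freely
    decouples the two sums; the excess terms, with [g] in [t], are subtracted. *)
Lemma inj_sumS k s : exists e : nat,
  inj_sum k.+1 s =
  (-1) ^+ e * (inj_sum k (relabel predn (nonzero_part s)) *
               power_sum (unzip2 (zero_part s)))
  - \sum_(j < k) inj_sum k (relabel (merge_label0 j) s).
Proof.
have [e splitE] := label_prod_split s; exists e; apply/eqP.
rewrite eq_sym subr_eq eq_sym; apply/eqP.
have -> : inj_sum k.+1 s =
    \sum_(t : k.-tuple I | uniq t) \sum_(g | g \notin t) label_prod (g :: t) s.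
  rewrite /inj_sum pair_big_dep /=.
  rewrite (reindex (fun p : k.-tuple I * I => cons_tuple p.2 p.1)) /=.
    by apply: eq_bigl => -[t g] /=; rewrite andbC.
  exists (fun t : k.+1.-tuple I => (behead_tuple t, thead t)) => [[t g] _|t _] /=.
    by congr pair; apply: val_inj.
  by rewrite [RHS]tuple_eta; apply: val_inj.
(* As [t] has no repetition, each [g] in [t] is its entry at exactly one [j]. *)
have -> : \sum_(j < k) inj_sum k (relabel (merge_label0 j) s) =
    \sum_(t : k.-tuple I | uniq t) \sum_(g in t) label_prod (g :: t) s.
  rewrite exchange_big /=; apply: eq_bigr => t ut.
  rewrite -big_uniq //= (big_nth g0) size_tuple big_mkord.
  by apply: eq_bigr => j _; rewrite label_prod_merge.
rewrite -big_split /= mulr_suml mulr_sumr; apply: eq_bigr => t _.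
rewrite addrC -(bigID (mem t) predT) /= mulr_sumr mulr_sumr.
apply: eq_bigr => g _.
by rewrite splitE label_prod_shift label_prod_zero.
Qed.

Lemma all_labels_used_merge k j s : (j < k.+1)%N ->
  all_labels_used k.+2 s -> all_labels_used k.+1 (relabel (merge_label0 j) s).
Proof.
move=> ltjk [/allP lt_s used]; split; rewrite unzip1_relabel.
  by apply/allP => _ /mapP[[|l] /lt_s ? ->].
move=> l; rewrite mem_iota add0n => lt_lk; apply/mapP; exists l.+1 => //.
by apply: used; rewrite mem_iota.
Qed.

Lemma all_labels_used_shift k s :
  all_labels_used k.+2 s -> all_labels_used k.+1 (relabel predn (nonzero_part s)).
Proof.
move=> [/allP lt_s used]; split; rewrite unzip1_relabel.
  apply/allP => _ /mapP[_ /mapP[p + ->] ->]; rewrite mem_filter => /andP[p0 sp].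
  by have := lt_s _ (map_f fst sp); case: (p.1) p0.
move=> l; rewrite mem_iota add0n => lt_lk.
have /mapP[p sp pE] : l.+1 \in unzip1 s by apply: used; rewrite mem_iota.
rewrite -[l]/(predn l.+1) pE; apply/map_f/map_f.
by rewrite mem_filter sp -pE.
Qed.

Lemma inj_sum1 s : all_labels_used 1 s -> inj_sum 1 s = power_sum (unzip2 s).
Proof.
move=> [/allP lt_s _]; rewrite /inj_sum /power_sum.
rewrite (reindex (fun g => [tuple g])) /=; last first.
  exists (fun t : 1.-tuple I => thead t) => [g _ //|t _].
  by apply: val_inj; case: t => -[|g []].
apply: eq_bigr => g _; rewrite /label_prod big_map !big_seq.
by apply: eq_bigr => p sp; have := lt_s _ (map_f fst sp); case: (p.1).
Qed.

(** * Reduction modulo a subalgebra containing the shorter power sums *)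

Variable B : {aspace A}.

(** Induction on the number of labels: in [inj_sumS] the product lies in [B], and merging labels
    leaves the word [unzip2 s] unchanged. *)
Lemma inj_sum_mod d k s :
    (forall w, (0 < size w < d)%N -> power_sum w \in B) ->
    all_labels_used k.+1 s -> (size s <= d)%N ->
  inj_sum k.+1 s - ((-1) ^+ k * k`!%:R) *: power_sum (unzip2 s) \in B.
Proof.
move=> ltB; elim: k s => [|k IHk] s s_used le_sd.
  by rewrite inj_sum1 // mul1r scale1r subrr mem0v.
have shift_used := all_labels_used_shift s_used.
have size_parts : (size (nonzero_part s) + size (zero_part s) = size s)%N.
  by rewrite addnC !size_filter -(count_predC (fun p => p.1 == 0) s).
have nz_gt0 : (0 < size (nonzero_part s))%N.
  case: shift_used => _ /(_ 0%N); rewrite mem_iota => /(_ isT) /=.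
  by case: (nonzero_part s).
have z_gt0 : (0 < size (zero_part s))%N.
  case: s_used => _ /(_ 0%N); rewrite mem_iota => /(_ isT) /mapP[p sp p0].
  by rewrite -has_predT; apply/hasP; exists p; rewrite // mem_filter -p0.
have [e ->] := inj_sumS k.+1 s.
rewrite -addrA -opprD rpredB //.
  have IHnz : power_sum (unzip2 (nonzero_part s)) \in B.
    by apply: ltB; rewrite size_map nz_gt0 (leq_trans _ le_sd) // -size_parts -addn1 leq_add2l.
  rewrite -signr_odd mulr_sign; set y := _ * _.
  suff yB : y \in B by case: ifP => _; rewrite ?rpredN.
  rewrite /y memvM //; last first.
    by apply: ltB; rewrite size_map z_gt0 (leq_trans _ le_sd) // -size_parts -add1n leq_add2r.
  (* The first factor is, modulo [B], a multiple of a shorter power sum, which is itself in [B]. *)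
  have := IHk _ shift_used; rewrite unzip2_relabel size_map.
  move=> /(_ (leq_trans _ le_sd)); rewrite -size_parts leq_addr => /(_ isT).
  by move=> /rpredD/(_ (memvZ ((-1) ^+ k * k`!%:R) IHnz)); rewrite subrK.
(* Each of the [k.+1] merged sums contributes the same multiple, turning [k!] into [(k+1)!]. *)
have -> : ((-1) ^+ k.+1 * (k.+1)`!%:R) *: power_sum (unzip2 s) =
   - \sum_(j < k.+1) ((-1) ^+ k * k`!%:R) *: power_sum (unzip2 s).
  rewrite sumr_const card_ord -scaler_nat scalerA -scaleNr; congr (_ *: _).
  by rewrite exprS mulN1r mulNr factS natrM mulrCA.
rewrite -sumrB rpred_sum // => j _.
have := IHk _ (all_labels_used_merge (ltn_ord j) s_used).
by rewrite unzip2_relabel size_map => /(_ le_sd).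
Qed.

Lemma inj_sum_eq0 k s : (#|I| < k)%N -> inj_sum k s = 0.
Proof.
move=> ltIk; rewrite /inj_sum big_pred0 // => t; apply/negP => /card_uniqP.
by rewrite size_tuple => tk; have := max_card (mem t); rewrite tk leqNgt ltIk.
Qed.

Hypothesis charK0 : [pchar K] =i pred0.

Lemma power_sum_mem w :
  (forall w', (0 < size w' <= #|I|)%N -> power_sum w' \in B) ->
  (0 < size w)%N -> power_sum w \in B.
Proof.
move=> leB; have [d] := ubnP (size w); elim: d w => // d IHd w le_wd w_gt0.
have [le_wI|lt_Iw] := leqP (size w) #|I|; first by rewrite leB ?w_gt0.
(* Every position gets its own label, so there are more labels than elements of [I]. *)
pose s := zip (iota 0 (size w)) w.
have sz : size (iota 0 (size w)) = size w by rewrite size_iota.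
have s1 : unzip1 s = iota 0 (size w) by rewrite unzip1_zip ?sz.
have s2 : unzip2 s = w by rewrite unzip2_zip ?sz.
have s_used : all_labels_used (size w) s.
  by split; rewrite s1 //; apply/allP => l; rewrite mem_iota.
have s_size : size s = size w by rewrite size_zip sz minnn.
case sw: (size w) w_gt0 => [//|k] _.
rewrite sw in s_used s_size lt_Iw le_wd.
have ltB w' : (0 < size w' < k.+1)%N -> power_sum w' \in B.
  by case/andP=> w'0 ltw'; apply: IHd => //; apply: leq_trans ltw' _.
have := inj_sum_mod ltB s_used; rewrite s_size => /(_ (leqnn _)).
rewrite inj_sum_eq0 // sub0r rpredN s2 => /(memvZ ((-1) ^+ k * k`!%:R)^-1).
rewrite scalerA mulVf ?scale1r // mulf_neq0 ?signr_eq0 //.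
by move/pcharf0P: charK0 => ->; rewrite -lt0n fact_gt0.
Qed.

End AnticommutingPowerSums.

(** * Transfers in the exterior algebra *)

Section ExteriorInvariants.

Variables (K : fieldType) (V : vectType K) (gT : finGroupType) (G : {group gT}).
Variable rho : gT -> 'End(V).
Hypothesis rhoG : linear_repr G rho.

(** Indexing by [[subg G]] gives an index type of cardinality [#|G|], so that power sums are
    transfers over [G]. *)
Definition orbit_vector (g : [subg G]) (v : V) : ext V :=
  ext_iota V (rho (sgval g) v).

Lemma orbit_vectorC g u h v :
  orbit_vector g u * orbit_vector h v = - (orbit_vector h v * orbit_vector g u).
Proof. exact: (ext_anticomm (@ext_iota_sqr0 _ V)). Qed.

Lemma ext_map_orbit_vector g h v : g \in G ->
  ext_map (rho g) (orbit_vector h v) = orbit_vector (subg G g * h)%g v.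
Proof.
move=> Gg; rewrite /orbit_vector ext_map_iota sgvalM ?inE // [sgval (subg G g)]subgK //.
by case: rhoG => _ ->; rewrite ?subgP // comp_lfunE.
Qed.

Lemma ext_map_prod u (T : Type) (r : seq T) (F : T -> ext V) :
  ext_map u (\prod_(i <- r) F i) = \prod_(i <- r) ext_map u (F i).
Proof. exact: (big_morph _ (ext_mapM u) (ext_map1 u)). Qed.

(** Left translation by an element of [G] permutes the summands. *)
Lemma power_sum_invariant w : power_sum orbit_vector w \in ext_invariants G rho.
Proof.
apply/ext_invariantsP => g Gg; rewrite linear_sum /=.
rewrite [RHS](reindex_inj (mulgI (subg G g))) /=; apply: eq_bigr => h _.
by rewrite ext_map_prod; apply: eq_bigr => v _; apply: ext_map_orbit_vector.
Qed.

Lemma power_sum_pow w : power_sum orbit_vector w \in ext_pow V (size w).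
Proof.
apply: rpred_sum => g _; elim: w => [|v w IHw]; first by rewrite big_nil memv_line.
by rewrite big_cons /ext_pow expvSl memv_mul // memv_img ?memvf.
Qed.

Lemma agenv_invariants_sub d :
  (agenv (ext_invariants G rho :&: ext_le V d) <= ext_invariants G rho)%VS.
Proof.
apply: agenv_sub_modl.
  by rewrite -memvE; apply/ext_invariantsP => g _; rewrite ext_map1.
apply: subv_trans (prodvSl _ (capvSl _ _)) _.
apply/prodvP => x y /ext_invariantsP Hx /ext_invariantsP Hy.
by apply/ext_invariantsP => g Gg; rewrite ext_mapM Hx ?Hy.
Qed.

Hypothesis charK0 : [pchar K] =i pred0.

Lemma invariants_sub_agenv :
  (ext_invariants G rho <= agenv (ext_invariants G rho :&: ext_le V #|G|))%VS.
Proof.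
set B := agenv _; apply/subvP => x /ext_invariantsP x_inv.
have card_sub : #|[subg G]| = #|G| by rewrite card_sub.
have ps_in w : power_sum orbit_vector w \in B.
  have leB w' : (size w' <= #|G|)%N -> power_sum orbit_vector w' \in B.
    move=> le_w'; apply: (subvP (sub_agenv _)); rewrite memv_cap power_sum_invariant.
    have lt_w' : (size w' < #|G|.+1)%N by [].
    by apply: subvP (power_sum_pow w'); apply: (sumv_sup (Ordinal lt_w')).
  (* The empty word, whose power sum is a scalar, is outside the scope of [power_sum_mem]. *)
  case: (posnP (size w)) => [w0|]; first by rewrite leB ?w0.
  apply: (@power_sum_mem _ _ _ _ _ orbit_vectorC 1%g (agenv_aspace _)) => // w'.
  by rewrite card_sub => /andP[_ /leB].
(* By linearity it suffices to sum over the orbit of a basis monomial, which gives a power sum. *)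
have sum_orbit : \sum_(g : [subg G]) ext_map (rho (sgval g)) x \in B.
  rewrite (ext_sum x); under eq_bigr => g _ do rewrite linear_sum.
  rewrite exchange_big rpred_sum //= => S _.
  under eq_bigr => g _ do rewrite linearZ /=.
  rewrite -scaler_sumr rpredZ //.
  have := ps_in [seq (vbasis {:V})`_i | i : 'I__ <- index_enum _ & i \in S].
  congr (_ \in B); apply: eq_bigr => g _.
  rewrite ext_basisE -[in RHS]big_filter ext_map_prod big_map.
  by apply: eq_bigr => i _; rewrite ext_map_iota.
have nG : #|G|%:R != 0 :> K.
  by move/pcharf0P: charK0 => ->; rewrite -lt0n cardG_gt0.
(* Reynolds averaging: the orbit sum of an invariant [x] is [#|G|] times [x]. *)
rewrite -[x]scale1r -(mulVf nG) -scalerA rpredZ //.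
move: sum_orbit; under eq_bigr => g _ do rewrite x_inv ?subgP //.
by rewrite sumr_const card_sub scaler_nat.
Qed.

End ExteriorInvariants.

Theorem theorem1 (K : fieldType) (charK0 : [pchar K]%R =i pred0)
    (gT : finGroupType) (G : {group gT}) (V : vectType K)
    (rho : gT -> 'End(V)) (rhoG : linear_repr G rho) :
  (ext_beta G rho <= #|G|)%N /\
  agenv (ext_invariants G rho :&: ext_le V #|G|)%VS = ext_invariants G rho.
Proof.
have gen : ext_generated G rho #|G|.
  by rewrite /ext_generated eqEsubv agenv_invariants_sub invariants_sub_agenv.
split; last exact/eqP.
by rewrite /ext_beta; case: ex_minnP => m _; apply.
Qed.
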